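(* Let $\phi$ be an unsatisfiable $3$-CNF and $G_\phi$ its adjacency graph. If Coverer wins the cover game $\mathsf{CoverGame}(G_\phi,\mu)$, then there is a $\mu$-winning strategy for $tr(\phi)$.
   Context: Let $X$ be the variables of $\phi$, $\overline X=\{\bar x: x\in X\}$, $\mathbb F$ a field. The adjacency graph $G_\phi$ is the bipartite graph with bipartition $(L,R)$, $L$ the clauses of $\phi$, $R = X$, and $C$ adjacent to $x$ iff $x$ or $\neg x$ occurs in $C$. A $(2,4)$-matching in a bipartite graph with bipartition $(L,R)$ is a subgraph $F$ whose connected components are trees with at most $4$ edges and in which each vertex of $V(F)\cap L$ has degree exactly $2$; $F$ covers $v$ if $v\in V(F)$. The cover game $\mathsf{CoverGame}(G,\mu)$ is played by Chooser and Coverer who maintain a $(2,4)$-matching $F_i$ in $G$ (initially empty); at step $i+1$ Chooser either removes a connected component of $F_i$, or, if $F_i$ has fewer than $\mu$ components, picks a vertex of $G$ and Coverer must produce a $(2,4)$-matching $F_{i+1}$ in $G$ covering that vertex in which every component of $F_i$ is a component of $F_{i+1}$; Coverer wins if she has a strategy answering every challenge in every play. The encoding is $tr(\phi) = \{tr(C): C\in\phi\}\cup\{x^2-x,\ x+\bar x-1: x\in X\}\subseteq\mathbb F[X,\overline X]$ with $tr(x)=\bar x$, $tr(\neg x)=x$, $tr(\ell_1\vee\dots\vee\ell_n)=\prod_i tr(\ell_i)$. Partial assignments $\alpha: X\to\{0,1,\star\}$ (domain $\alpha^{-1}(\{0,1\})$, extended by $\alpha(\bar x)=1-\alpha(x)$;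 $\star$ has empty domain); $\alpha\models p$ means substituting $\alpha$ into $p$ gives the zero polynomial. A set $A$ of partial assignments is flippable if for every $x$ in the union of their domains there are $\alpha,\beta\in A$ with $\alpha(x)=1-\beta(x)$. For non-empty pairwise domain-disjoint $H_1,\dots,H_t$, the product-family $H_1\otimes\dots\otimes H_t=\{\alpha_1\cup\dots\cup\alpha_t:\alpha_i\in H_i\}$ ($\{\star\}$ if $t=0$); it is flippable if every factor $H_i$ is flippable; its rank $\|\mathcal H\|$ is the number of factors different from $\{\star\}$; $\mathcal H'\sqsubseteq\mathcal H$ means every factor of $\mathcal H'$ other than $\{\star\}$ is a factor of $\mathcal H$; $\mathcal H\models p$ means $\alpha\models p$ for all $\alpha\in\mathcal H$. For a set $P$ of polynomials, a non-empty family $\mathcal L$ of flippable product-families is a $k$-winning strategy for $P$ if for every $\mathcal H\in\mathcal L$: every $\mathcal H'\sqsubseteq\mathcal H$ lies in $\mathcal L$, and if $\|\mathcal H\|<k$ then for each $p\in P$ there is a flippable product-family $\mathcal H'\in\mathcal L$ with $\mathcal H\sqsubseteq\mathcal H'$ and $\mathcal H'\models p$. *)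

(* Defs.v *)
From HB Require Import structures.
From mathcomp Require Import all_boot all_order all_algebra.
From mathcomp Require Import multinomials.mpoly.

Set Implicit Arguments.
Unset Strict Implicit.
Unset Printing Implicit Defensive.

Import GRing.Theory.
Local Open Scope ring_scope.

(** * CNF formulas *)

(* [(x, true)] is the literal x and [(x, false)] is its negation. *)
Definition literal (X : finType) : finType := (X * bool)%type.
Definition clause (X : finType) : finType := {set literal X}.
Definition cnf (X : finType) : finType := {set clause X}.

Definition occurs (X : finType) (x : X) (C : clause X) : bool :=
  ((x, true) \in C) || ((x, false) \in C).

Definition variables (X : finType) (phi : cnf X) : {set X} :=
  [set x | [exists C in phi, occurs x C]].

Definition is_kcnf (X : finType) (k : nat) (phi : cnf X) : Prop :=
  forall C : clause X, C \in phi -> (#|C| <= k)%N.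

Definition satisfiable (X : finType) (phi : cnf X) : Prop :=
  exists a : X -> bool, forall C : clause X, C \in phi ->
    exists2 l : literal X, l \in C & a l.1 = l.2.

(** * Bipartite graphs and (2,4)-matchings *)

(* A bipartite graph with bipartition (L, R) is its adjacency relation
   [G : L -> R -> bool]; its vertices are the elements of [L + R]. *)

(* A pair (vertex set, edge set); [is_subgraph] adds the incidence
   requirements. *)
Definition subgraph (L R : finType) : finType :=
  ({set (L + R)%type} * {set (L * R)%type})%type.

Definition sgV (L R : finType) (F : subgraph L R) : {set (L + R)%type} := F.1.
Definition sgE (L R : finType) (F : subgraph L R) : {set (L * R)%type} := F.2.

Definition is_subgraph (L R : finType) (G : L -> R -> bool)
    (F : subgraph L R) : Prop :=
  forall (l : L) (r : R), (l, r) \in sgE F ->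
    [/\ G l r, inl l \in sgV F & inr r \in sgV F].

Definition sg_adj (L R : finType) (F : subgraph L R) : rel (L + R)%type :=
  fun u v => match u, v with
    | inl l, inr r => (l, r) \in sgE F
    | inr r, inl l => (l, r) \in sgE F
    | _, _ => false
    end.

Definition component_of (L R : finType) (F : subgraph L R) (v : L + R)
    : subgraph L R :=
  ([set w | connect (sg_adj F) v w],
   [set e in sgE F | connect (sg_adj F) v (inl e.1)]).

Definition components (L R : finType) (F : subgraph L R)
    : {set subgraph L R} :=
  [set component_of F v | v in sgV F].

Definition is_tree (L R : finType) (K : subgraph L R) : Prop :=
  [/\ sgV K != set0,
      {in sgV K &, forall u v, connect (sg_adj K) u v}
    & forall c : seq (L + R), ucycle (sg_adj K) c -> (size c <= 2)%N].

Definition matching24 (L R : finType) (G : L -> R -> bool)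
    (F : subgraph L R) : Prop :=
  [/\ is_subgraph G F,
      forall K, K \in components F -> is_tree K /\ (#|sgE K| <= 4)%N
    & forall l : L, inl l \in sgV F -> #|[set r | (l, r) \in sgE F]| = 2%N].

(** * The cover game *)

Inductive move (L R : finType) : Type :=
  | Remove of subgraph L R
  | Pick of (L + R)%type.
Arguments Remove {L R} _.
Arguments Pick {L R} _.

(* Histories list the moves of Chooser, most recent first. Given the strategy
   they determine the play, so a strategy for Coverer maps a history and a
   newly picked vertex to a response. *)
Definition strategy (L R : finType) : Type :=
  seq (move L R) -> (L + R)%type -> subgraph L R.

Definition remove_component (L R : finType) (F K : subgraph L R)
    : subgraph L R :=
  (sgV F :\: sgV K, sgE F :\: sgE K).

Fixpoint position (L R : finType) (s : strategy L R)
    (h : seq (move L R)) : subgraph L R :=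
  match h with
  | [::] => (set0, set0)
  | Remove K :: h' => remove_component (position s h') K
  | Pick v :: h' => s h' v
  end.

Fixpoint legal (L R : finType) (mu : nat) (s : strategy L R)
    (h : seq (move L R)) : bool :=
  match h with
  | [::] => true
  | Remove K :: h' => legal mu s h' && (K \in components (position s h'))
  | Pick v :: h' => legal mu s h' && (#|components (position s h')| < mu)%N
  end.

Definition valid_response (L R : finType) (G : L -> R -> bool)
    (F : subgraph L R) (v : L + R) (F' : subgraph L R) : Prop :=
  [/\ matching24 G F', v \in sgV F' & components F \subset components F'].

Definition coverer_wins (L R : finType) (G : L -> R -> bool) (mu : nat)
    : Prop :=
  exists s : strategy L R, forall (h : seq (move L R)) (v : L + R),
    legal mu s (Pick v :: h) -> valid_response G (position s h) v (s h v).

(** * The adjacency graph of a formula *)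

Definition clause_of (X : finType) (phi : cnf X) : finType :=
  {C : clause X | C \in phi}.

Definition adjacency_graph (X : finType) (phi : cnf X)
    : clause_of phi -> X -> bool :=
  fun C x => occurs x (val C).
Arguments adjacency_graph {X} phi _ _.

(** * The polynomial encoding *)

(* The indeterminates are indexed by [literal X]: [(x, true)] stands for x and
   [(x, false)] for its twin x-bar. *)
Definition nvars (X : finType) : nat := #|literal X|.

Definition pvar (X : finType) (F : fieldType) (v : literal X)
    : {mpoly F[nvars X]} := 'X_(enum_rank v).

Definition tr_literal (X : finType) (F : fieldType) (l : literal X)
    : {mpoly F[nvars X]} := pvar F (l.1, ~~ l.2).

Definition tr_clause (X : finType) (F : fieldType) (C : clause X)
    : {mpoly F[nvars X]} := \prod_(l in C) tr_literal F l.

Definition tr_cnf (X : finType) (F : fieldType) (phi : cnf X)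
    (p : {mpoly F[nvars X]}) : Prop :=
  [\/ exists2 C : clause X, C \in phi & p = tr_clause F C,
      exists x : X, p = pvar F (x, true) ^+ 2 - pvar F (x, true)
    | exists x : X, p = pvar F (x, true) + pvar F (x, false) - 1].
Arguments tr_cnf {X} F phi p.

(** * Partial assignments *)

(* [None] is the value star. *)
Definition passign (X : finType) : finType := {ffun X -> option bool}.

Definition star (X : finType) : passign X := [ffun=> None].

Definition dom (X : finType) (a : passign X) : {set X} :=
  [set x | a x != None].

Definition passign_union (X : finType) (a b : passign X) : passign X :=
  [ffun x => if a x is Some c then Some c else b x].

(* Unassigned indeterminates are left in place. *)
Definition subst_var (X : finType) (F : fieldType) (a : passign X)
    (v : literal X) : {mpoly F[nvars X]} :=
  match a v.1 with
  | Some c => let value : nat := c in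
              if v.2 then value%:R else 1 - value%:R
  | None => pvar F v
  end.

Definition substitute (X : finType) (F : fieldType) (a : passign X)
    (p : {mpoly F[nvars X]}) : {mpoly F[nvars X]} :=
  comp_mpoly [tuple subst_var F a (enum_val i) | i < nvars X] p.

Definition models (X : finType) (F : fieldType) (a : passign X)
    (p : {mpoly F[nvars X]}) : Prop := substitute a p = 0.

Definition set_dom (X : finType) (H : {set passign X}) : {set X} :=
  \bigcup_(a in H) dom a.

Definition flippable (X : finType) (H : {set passign X}) : Prop :=
  forall x : X, x \in set_dom H -> exists a b : passign X,
    [/\ a \in H, b \in H & exists2 c, a x = Some c & b x = Some (~~ c)].

(** * Product-families *)

(* A product-family H_1 (x) ... (x) H_t is the formal product, given by its
   list of factors: the rank and the order below depend on the factors, and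
   not only on the set of assignments that they generate. *)
Notation factors X := (seq {set passign X}).

Definition is_product_family (X : finType) (H : factors X) : Prop :=
  all (fun A => A != set0) H
  /\ pairwise (fun A B => [disjoint set_dom A & set_dom B]) H.

Definition product_set (X : finType) (H : factors X) : {set passign X} :=
  foldr (fun A B : {set passign X} =>
           [set passign_union a b | a in A, b in B])
        [set star X] H.

Definition pf_flippable (X : finType) (H : factors X) : Prop :=
  forall A : {set passign X}, A \in H -> flippable A.

Definition rank (X : finType) (H : factors X) : nat :=
  count (fun A => A != [set star X]) H.

Definition pf_le (X : finType) (H' H : factors X) : Prop :=
  forall A : {set passign X}, A \in H' -> A != [set star X] -> A \in H.

Definition pf_models (X : finType) (F : fieldType) (H : factors X)
    (p : {mpoly F[nvars X]}) : Prop :=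
  forall a, a \in product_set H -> models a p.

Definition winning_strategy (X : finType) (F : fieldType) (k : nat)
    (P : {mpoly F[nvars X]} -> Prop) (S : factors X -> Prop) : Prop :=
  [/\ exists H, S H,
      forall H, S H -> is_product_family H /\ pf_flippable H,
      forall H H', S H -> is_product_family H' -> pf_le H' H -> S H'
    & forall H p, S H -> (rank H < k)%N -> P p ->
        exists H', [/\ S H', pf_le H H' & pf_models H' p]].

(* Main.v *)
(* Coverer keeps a matching whose components K each carry the family of all
   assignments to the variables of K that satisfy every clause of K. A component
   has at most two clauses, each with two neighbours, and no 4-cycle; so after
   fixing any variable x of K to any value, each clause of K can still be given
   a private neighbour other than x, which is set so as to satisfy it. Hence
   these families are flippable, and those arising along plays won by Coverer
   form a winning strategy: passing to a smaller product-family amounts to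
   removing components, and answering a polynomial amounts to picking the
   corresponding clause or variable. *)

Require Import Defs.
From mathcomp Require Import all_boot all_order all_algebra.
From mathcomp Require Import multinomials.mpoly.

Set Implicit Arguments.
Unset Strict Implicit.
Unset Printing Implicit Defensive.

Import GRing.Theory.

(** * Components of bipartite subgraphs and of (2,4)-matchings *)

Section Components.
Variables (L R : finType).
Implicit Types (F K : subgraph L R) (u v w : L + R).

Lemma sg_adj_sym F : ssrbool.symmetric (sg_adj F).
Proof. by case=> [l|r] [l'|r']. Qed.

Lemma connect_sg_sym F : connect_sym (sg_adj F).
Proof. by apply: sym_connect_sym; apply: sg_adj_sym. Qed.

Lemma component_of_eq F v w :
  connect (sg_adj F) v w -> component_of F v = component_of F w.
Proof.
move=> vw; rewrite /component_of; congr pair; apply/setP=> z;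
  by rewrite !inE (same_connect (connect_sg_sym F) vw).
Qed.

Lemma mem_component_of F v : v \in sgV (component_of F v).
Proof. by rewrite inE connect0. Qed.

Lemma components_disjoint F K K' :
  K \in components F -> K' \in components F -> K != K' ->
  [disjoint sgV K & sgV K'].
Proof.
move=> /imsetP[v _ ->] /imsetP[v' _ ->]; apply: contraR.
case/pred0Pn=> w /andP[]; rewrite !inE => vw v'w.
by rewrite (component_of_eq vw) (component_of_eq v'w).
Qed.

(** A path starting outside the component of [v] never enters it, so all its edges survive the
    removal. *)
Lemma connect_remove F v w z : ~~ connect (sg_adj F) v w ->
  connect (sg_adj (remove_component F (component_of F v))) w z
    = connect (sg_adj F) w z.
Proof.
set F' := remove_component _ _ => nvw.
apply/idP/idP.
  apply: connect_sub => {nvw}a b; case: a b => [l|r] [l'|r'] //=;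
  by rewrite !inE => /andP[_ e]; apply: connect1.
case/connectP=> p + ->; elim: p w nvw => [|y p IH] w nvw /=.
  by rewrite connect0.
case/andP=> wy py.
have nvy : ~~ connect (sg_adj F) v y.
  apply: contra nvw => vy; apply: connect_trans vy _.
  by rewrite connect_sg_sym connect1.
apply: connect_trans (IH y nvy py); apply: connect1.
case: w y wy nvw nvy {IH py} => [l|r] [l'|r'] //= e n1 n2;
  rewrite !inE e /= andbT //.
Qed.

Lemma components_remove F K : K \in components F ->
  components (remove_component F K) = components F :\ K.
Proof.
case/imsetP=> v vF ->; set F' := remove_component _ _.
have comp_eq w : ~~ connect (sg_adj F) v w ->
    component_of F' w = component_of F w.
  move=> nvw; rewrite /component_of; congr pair; apply/setP=> z.
    by rewrite !inE connect_remove.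
  rewrite !inE connect_remove //; case: (boolP (connect _ w _)); rewrite ?andbF //.
  move=> wz; rewrite !andbT; have [zE|] := boolP (z \in sgE F); rewrite ?andbF //.
  rewrite !andbT; apply: contra nvw => vz; apply: connect_trans vz _.
  by rewrite connect_sg_sym.
apply/setP=> K'; rewrite in_setD1; apply/imsetP/andP.
  case=> w; rewrite !inE => /andP[nvw wF] ->; rewrite comp_eq //; split.
    apply: contra nvw => /eqP E; have := mem_component_of F w.
    by rewrite E inE.
  exact: imset_f.
case=> nK /imsetP[w wF K'E]; exists w; last first.
  rewrite comp_eq //; apply: contra nK => vw.
  by rewrite K'E (component_of_eq vw).
rewrite !inE wF andbT; apply: contra nK => vw.
by rewrite K'E (component_of_eq vw).
Qed.

Lemma components_empty : components (set0, set0) = set0 :> {set subgraph L R}.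
Proof. by rewrite /components /sgV /= imset0. Qed.

Definition clause_side K : {set L} := [set l | inl l \in sgV K].
Definition var_side K : {set R} := [set r | inr r \in sgV K].
Definition nbrs K (l : L) : {set R} := [set r | (l, r) \in sgE K].

(** What later arguments retain of a component of a (2,4)-matching. Injectivity of [nbrs] encodes
    the absence of 4-cycles. *)
Definition good_component (G : L -> R -> bool) K : Prop :=
  [/\ (#|clause_side K| <= 2)%N,
      {in clause_side K, forall l, #|nbrs K l| = 2},
      {in clause_side K &, injective (nbrs K)},
      forall l r, r \in nbrs K l -> G l r && (r \in var_side K)
    & exists r, r \in var_side K].

Lemma sum_nbrs K : \sum_l #|nbrs K l| = #|sgE K|.
Proof.
transitivity (\sum_l \sum_r ((l, r) \in sgE K : nat)).
  apply: eq_bigr => l _; rewrite -sum1_card big_mkcond /=.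
  by apply: eq_bigr => r _; rewrite inE; case: (_ \in _).
rewrite pair_bigA -sum1_card [RHS]big_mkcond /=.
by apply: eq_bigr => -[l r] _ /=; case: (_ \in _).
Qed.

(** Two clauses with the same two neighbours would close a 4-cycle, whereas in a tree a [ucycle] is
    at most an edge walked back and forth. *)
Lemma tree_nbrs_inj K : is_tree K ->
  {in clause_side K, forall l, #|nbrs K l| = 2} ->
  {in clause_side K &, injective (nbrs K)}.
Proof.
move=> [_ _ acyc] deg C D CK DK ECD; apply/eqP/negPn/negP => CD.
have /eqP/cards2P[y [z [yz NE]]] := deg C CK.
have [Cy Cz] : (C, y) \in sgE K /\ (C, z) \in sgE K.
  by split; move/setP: NE => /(_ _); [move/(_ y) | move/(_ z)];
    rewrite !inE eqxx ?orbT.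
have [Dy Dz] : (D, y) \in sgE K /\ (D, z) \in sgE K.
  by rewrite ECD in NE; split; move/setP: NE => /(_ _);
    [move/(_ y) | move/(_ z)]; rewrite !inE eqxx ?orbT.
suff /acyc : ucycle (sg_adj K) [:: inl C; inr y; inl D; inr z] by [].
rewrite /ucycle /= Cy Cz Dy Dz /= !inE /=.
have -> : (inl C == inl D :> L + R) = false by apply/eqP=> -[E]; rewrite E eqxx in CD.
by have -> : (inr y == inr z :> L + R) = false by apply/eqP=> -[E]; rewrite E eqxx in yz.
Qed.

Lemma matching24_good G F K :
  matching24 G F -> K \in components F -> good_component G K.
Proof.
move=> [sub comp deg] KF; have [tree le4] := comp K KF.
case/imsetP: (KF) => v vF KE.
have clos : closed (sg_adj F) (mem (sgV F)).
  by case=> [l|r] [l'|r'] //= /sub[_ ? ?]; apply/idP/idP.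
have KV w : w \in sgV K -> w \in sgV F.
  by rewrite KE inE => vw; rewrite -(closed_connect clos vw).
(* A component keeps every edge of [F] at its clauses, so degree 2 carries over from [F] to [K]. *)
have KN l : l \in clause_side K -> nbrs K l = [set r | (l, r) \in sgE F].
  by rewrite inE KE inE => vl; apply/setP=> r; rewrite !inE /= vl andbT.
have degK : {in clause_side K, forall l, #|nbrs K l| = 2}.
  by move=> l lK; rewrite KN // deg // KV //; rewrite inE in lK.
have edge l r : r \in nbrs K l -> G l r && (r \in var_side K).
  rewrite inE KE inE => /andP[e vl]; have [-> _ _] := sub _ _ e.
  by rewrite !inE; apply: connect_trans vl _; apply: connect1.
split=> //; last first.
- have : v \in sgV K by rewrite KE mem_component_of.
  case: v vF KE => [l|r] _ _ vK; last by exists r; rewrite inE.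
  have lK : l \in clause_side K by rewrite inE.
  have /eqP := degK l lK; case: (set_0Vmem (nbrs K l)) => [->|[r rl]].
    by rewrite cards0.
  by exists r; case/andP: (edge _ _ rl).
- exact: tree_nbrs_inj.
(* Counting edges by clauses: twice the number of clauses is at most the number of edges, hence at
   most 4. *)
rewrite -(leq_pmul2l (isT : 0 < 2)%N); apply: leq_trans le4.
rewrite -sum_nbrs (bigID (mem (clause_side K))) /=.
rewrite (eq_bigr (fun=> 2)) // sum_nat_const mulnC.
exact: leq_addr.
Qed.

End Components.

(** A case of Hall's theorem: two 2-sets fail to have distinct representatives avoiding [x] only if
    deleting [x] leaves the same singleton in both, and then the sets are equal. *)
Lemma private_representatives (L R : finType) (A : {set L}) (N : L -> {set R})
    (x : R) :
  (#|A| <= 2)%N -> {in A, forall l, #|N l| = 2} -> {in A &, injective N} ->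
  exists2 m : L -> R, {in A, forall l, m l \in N l :\ x} & {in A &, injective m}.
Proof.
move=> A2 N2 Ninj.
have pickN l (z : R) : l \in A -> exists2 y, y \in N l & y != z.
  move=> lA; have /eqP/cards2P[a [b [ab ->]]] := N2 l lA.
  have [<-|] := eqVneq a z; last by exists a; rewrite ?set21.
  by exists b; rewrite ?set22 // eq_sym.
have [A1|A1] := leqP #|A| 1.
  (* The default [x] is never taken on [A], where [N l :\ x] is non-empty. *)
  exists (fun l => odflt x [pick y in N l :\ x]).
    move=> l lA; case: pickP => //= E; have [y yl yx] := pickN l x lA.
    by have := E y; rewrite !inE yl yx.
  by move=> l l' lA l'A _; apply: (card_le1_eqP A1).
have /cards2P[C [D [CD AE]]] : #|A| == 2 by rewrite eqn_leq A2.
have CA : C \in A by rewrite AE set21.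
have DA : D \in A by rewrite AE set22.
suff [y [z [yC zD yz]]] : exists y z, [/\ y \in N C :\ x, z \in N D :\ x & y != z].
  have DC : (D == C) = false by rewrite eq_sym (negbTE CD).
  exists (fun l => if l == C then y else z).
    by move=> l; rewrite AE !inE => /orP[]/eqP->; rewrite ?eqxx ?DC //;
      rewrite -in_setD1.
  move=> l l'; rewrite AE !inE => /orP[]/eqP-> /orP[]/eqP->; rewrite ?eqxx ?DC //.
    by move/eqP; rewrite (negbTE yz).
  by move/esym/eqP; rewrite (negbTE yz).
have [y yC yx] := pickN C x CA.
have [z zD zx] := pickN D x DA.
have [yz|yz] := eqVneq y z; last by exists y, z; rewrite !inE yx zx yC zD.
rewrite -{z}yz in zD zx *.
have : N C != N D by apply: contra CD => /eqP/Ninj->.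
have [y' y'C y'y] := pickN C y CA.
have [z' z'D z'y] := pickN D y DA.
have pairE l u v : l \in A -> u \in N l -> v \in N l -> v != u -> N l = [set u; v].
  move=> lA ul vl vu; apply/esym/eqP.
  by rewrite eqEcard subUset !sub1set ul vl cards2 eq_sym vu N2.
rewrite (pairE C y y') // (pairE D y z') // => NN.
(* Both choices are [y], so one must move: [C] takes [y'] unless that is [x], in which case [D]
   takes [z']. *)
have [y'x|y'x] := eqVneq y' x; last first.
  by exists y', y; rewrite !inE y'x yx y'y !eqxx ?orbT.
exists y, z'; rewrite !inE yx !eqxx orbT andbT [y == z']eq_sym z'y; split=> //.
by apply: contra NN => /eqP->; rewrite y'x.
Qed.

(** * Families of partial assignments attached to components *)

Section Families.
Variable (X : finType).
Implicit Types (a b : passign X) (A : {set passign X}) (H : factors X).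

Definition sat_clause a (C : clause X) : bool :=
  [exists l in C, a l.1 == Some l.2].

(** The domain is prescribed exactly, so that every variable of [K] gets a value and its Boolean and
    twin axioms vanish. *)
Definition component_family (phi : cnf X) (K : subgraph (clause_of phi) X) :
    {set passign X} :=
  [set a | (dom a == var_side K)
           && [forall C, (C \in clause_side K) ==> sat_clause a (val C)]].

Lemma dom_star : dom (star X) = set0.
Proof. by apply/setP=> x; rewrite !inE ffunE. Qed.

Lemma set_dom_star : set_dom [set star X] = set0.
Proof. by rewrite /set_dom big_set1 dom_star. Qed.

Lemma flippable_star : flippable [set star X].
Proof. by move=> x; rewrite set_dom_star inE. Qed.

Lemma set_dom_component_family phi (K : subgraph (clause_of phi) X) :
  set_dom (component_family K) \subset var_side K.
Proof. by apply/bigcupsP => a; rewrite inE => /andP[/eqP->]. Qed.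

(** Common source of flippability, non-emptiness and non-triviality of the families. The clauses of
    [K] are satisfied through private variables other than [x], which leaves [x] free. *)
Lemma component_family_value phi (K : subgraph (clause_of phi) X) x c :
  good_component (adjacency_graph phi) K -> x \in var_side K ->
  exists2 a, a \in component_family K & a x = Some c.
Proof.
move=> [K2 deg inj edge _] xK.
have [m mN minj] := private_representatives x K2 deg inj.
(* A private variable takes the sign with which it occurs in its clause (positive if both occur);
   the other variables of [K] except [x] get the arbitrary value [false]. *)
pose a : passign X := [ffun v =>
  if v \notin var_side K then None else if v == x then Some c else
  if [pick C in clause_side K | m C == v] is Some C
  then Some ((v, true) \in val C) else Some false].
exists a; last by rewrite ffunE xK eqxx.
rewrite inE; apply/andP; split.
  apply/eqP/setP=> v; rewrite [LHS]inE ffunE.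
  by case: (v \in var_side K) => //=; case: (v == x) => //; case: pickP.
apply/forallP=> C; apply/implyP=> CK.
have := mN C CK; rewrite in_setD1 => /andP[mx /edge/andP[occ mK]].
(* Injectivity of [m] forces the clause picked for [m C] to be [C] itself. *)
have am : a (m C) = Some ((m C, true) \in val C).
  rewrite ffunE mK (negbTE mx) /=; case: pickP => [D /andP[DK /eqP/minj->//]|].
  by move/(_ C); rewrite CK eqxx.
apply/existsP; exists (m C, (m C, true) \in val C); rewrite /= am eqxx andbT.
by move: occ; rewrite /adjacency_graph /occurs; case E: ((m C, true) \in val C).
Qed.

Lemma component_family_flippable phi (K : subgraph (clause_of phi) X) :
  good_component (adjacency_graph phi) K -> flippable (component_family K).
Proof.
move=> gK x /(subsetP (set_dom_component_family K)) xK.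
have [a aK ax] := component_family_value true gK xK.
have [b bK bx] := component_family_value false gK xK.
by exists a, b; split=> //; exists true.
Qed.

Lemma component_family_neq0 phi (K : subgraph (clause_of phi) X) :
  good_component (adjacency_graph phi) K -> component_family K != set0.
Proof.
move=> gK; have [_ _ _ _ [x xK]] := gK.
have [a aK _] := component_family_value true gK xK.
by apply/set0Pn; exists a.
Qed.

Lemma component_family_neq_star phi (K : subgraph (clause_of phi) X) :
  good_component (adjacency_graph phi) K -> component_family K != [set star X].
Proof.
move=> gK; have [_ _ _ _ [x xK]] := gK.
have [a aK ax] := component_family_value true gK xK.
apply: contraTneq aK => ->; rewrite inE; apply/eqP=> aE.
by rewrite aE ffunE in ax.
Qed.

Lemma component_family_disjoint phi (F K K' : subgraph (clause_of phi) X) :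
  K \in components F -> K' \in components F -> K != K' ->
  [disjoint set_dom (component_family K) & set_dom (component_family K')].
Proof.
move=> KF K'F KK'; apply: disjointWl (set_dom_component_family _) _.
apply: disjointWr (set_dom_component_family _) _.
have := components_disjoint KF K'F KK'; rewrite !disjoint_subset.
by move/subsetP=> D; apply/subsetP=> x; rewrite !inE => /D; rewrite !inE.
Qed.

(** A family shared by two components would have a domain disjoint from itself, hence empty,
    although each variable of [K] is assigned by some member. *)
Lemma component_family_inj phi (F : subgraph (clause_of phi) X) :
  (forall K, K \in components F -> good_component (adjacency_graph phi) K) ->
  {in components F &, injective (@component_family phi)}.
Proof.
move=> gF K K' KF K'F E; apply/eqP; apply: contraT => KK'.
have := component_family_disjoint KF K'F KK'; rewrite -E -setI_eq0 setIid => /eqP E0.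
have gK := gF K KF; have [_ _ _ _ [x xK]] := gK.
have [a aK ax] := component_family_value true gK xK.
suff : x \in set0 by rewrite inE.
by rewrite -E0; apply/bigcupP; exists a; rewrite // inE ax.
Qed.

(** * Product-families and their rank *)

(** As [passign_union] prefers its first argument, values from later factors survive thanks to the
    disjointness of domains. *)
Lemma product_set_extends H A a :
  is_product_family H -> A \in H -> a \in product_set H ->
  exists2 b, b \in A & forall x c, b x = Some c -> a x = Some c.
Proof.
case=> _; elim: H a => [|B H IH] a //= /andP[disj pw] AH.
case/imset2P=> a1 a2 a1B a2H ->.
move: AH; rewrite inE => /predU1P[->|AH].
  by exists a1 => // x c E; rewrite ffunE E.
have [b bA ext] := IH a2 pw AH a2H; exists b => // x c bx.
rewrite ffunE (ext _ _ bx); case E: (a1 x) => [d|//].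
have BA : [disjoint set_dom B & set_dom A] := allP disj A AH.
have xB : x \in set_dom B by apply/bigcupP; exists a1; rewrite ?inE ?E.
have xA : x \in set_dom A by apply/bigcupP; exists b; rewrite ?inE ?bx.
by rewrite (disjointFr BA xB) in xA.
Qed.

(** The domain of a repeated factor is disjoint from itself, hence empty, and a non-empty family
    with empty domain is [[set star X]]. *)
Lemma product_family_uniq H : is_product_family H ->
  uniq [seq A <- H | A != [set star X]].
Proof.
case=> + pw; elim: H pw => [|A H IH] //= /andP[disj pw] /andP[A0 H0].
case: ifP => [As|_]; rewrite ?(IH pw H0) //= (IH pw H0) andbT.
rewrite mem_filter As /=; apply: contra As => AH.
have := allP disj A AH; rewrite -setI_eq0 setIid => /eqP dA.
have st a : a \in A -> a = star X.
  move=> aA; apply/ffunP=> x; rewrite ffunE; case E: (a x) => [c|//].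
  suff : x \in set0 by rewrite inE.
  by rewrite -dA; apply/bigcupP; exists a; rewrite ?inE ?E.
rewrite eqEsubset; apply/andP; split.
  by apply/subsetP=> a /st->; rewrite inE.
by have /set0Pn[a aA] := A0; rewrite sub1set -(st a aA).
Qed.

Lemma rank_card H : is_product_family H ->
  rank H = #|[set A | (A \in H) && (A != [set star X])]|.
Proof.
move=> pfH; rewrite /rank -size_filter -(card_uniqP (product_family_uniq pfH)).
by apply: eq_card => A; rewrite inE mem_filter andbC.
Qed.

Lemma component_families_product phi (F : subgraph (clause_of phi) X) :
  (forall K, K \in components F -> good_component (adjacency_graph phi) K) ->
  is_product_family [seq component_family K | K <- enum (components F)].
Proof.
move=> gF; split.
  apply/allP=> A /mapP[K]; rewrite mem_enum => KF ->.
  exact/component_family_neq0/gF.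
rewrite pairwise_map.
have : pairwise [rel K K' | K != K'] (enum (components F)).
  by rewrite -uniq_pairwise enum_uniq.
apply: sub_in_pairwise (allss _) => K K'; rewrite !mem_enum => KF K'F /=.
by move=> ?; apply: component_family_disjoint KF K'F _.
Qed.

(** * Substitution into the encoding polynomials *)

Local Open Scope ring_scope.
Variable (F : fieldType).

Lemma substitute_pvar a (v : literal X) :
  substitute a (pvar F v) = subst_var F a v.
Proof.
by rewrite /substitute /pvar comp_mpolyXU -tnth_nth tnth_mktuple enum_rankK.
Qed.

(** A true literal is translated to the indeterminate of its negation, which receives 0 and kills
    the product. *)
Lemma models_clause a (C : clause X) : sat_clause a C -> models a (tr_clause F C).
Proof.
case/existsP=> l /andP[lC /eqP al]; rewrite /models /substitute rmorph_prod.
rewrite (bigD1 l) //= -/(substitute a (tr_literal F l)) substitute_pvar.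
by rewrite /subst_var /= al; case: (l.2); rewrite /= ?subrr mul0r.
Qed.

Lemma models_boolean a x c : a x = Some c ->
  models a (pvar F (x, true) ^+ 2 - pvar F (x, true)).
Proof.
move=> ax; rewrite /models /substitute rmorphB rmorphXn /=.
rewrite -/(substitute a _) substitute_pvar /subst_var /= ax.
by case: c {ax}; rewrite /= ?expr1n ?expr0n subrr.
Qed.

Lemma models_twin a x c : a x = Some c ->
  models a (pvar F (x, true) + pvar F (x, false) - 1).
Proof.
move=> ax; rewrite /models /substitute rmorphB rmorphD rmorph1 /=.
rewrite -!/(substitute a _) !substitute_pvar /subst_var /= ax.
by rewrite addrCA subrr addr0 subrr.
Qed.

End Families.

(** * Positions along plays won by Coverer *)

Section Play.
Variables (L R : finType) (G : L -> R -> bool) (mu : nat) (s : strategy L R).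

(** Goodness concerns single components, so it survives removals; after a pick it holds because the
    response is a (2,4)-matching. *)
Lemma legal_good (h : seq (move L R)) :
  (forall h v, legal mu s (Defs.Pick v :: h) -> valid_response G (position s h) v (s h v)) ->
  legal mu s h -> forall K, K \in components (position s h) -> good_component G K.
Proof.
move=> win; elim: h => [|[K0|v] h IH] leg K /=; first by rewrite components_empty inE.
  case/andP: leg => leg K0h; rewrite components_remove // in_setD1 => /andP[_].
  exact: IH.
by have [m _ _] := win h v leg; apply: matching24_good.
Qed.

(** The game counterpart of passing to a smaller product-family: surplus components are removed one
    by one, by induction on their number. *)
Lemma legal_remove (h : seq (move L R)) (T : {set subgraph L R}) :
  legal mu s h -> T \subset components (position s h) ->
  exists2 h', legal mu s h' & components (position s h') = T.
Proof.
move En: #|components (position s h) :\: T| => n.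
elim: n h En => [|n IH] h En leg sub.
  exists h => //; apply/eqP; rewrite eqEsubset sub andbT -setD_eq0.
  by rewrite -cards_eq0 En.
have /card_gt0P[K KD] : (0 < #|components (position s h) :\: T|)%N by rewrite En.
have := KD; rewrite inE => /andP[KT KF].
apply: (IH (Remove K :: h)) => /=; last 1 first.
- by rewrite components_remove // subsetD1 sub.
- rewrite components_remove // setDDl setUC -setDDl.
  by have := cardsD1 K (components (position s h) :\: T); rewrite KD En => -[].
by rewrite leg.
Qed.

End Play.

Theorem theorem21 (F : fieldType) (X : finType) (phi : cnf X) (mu : nat)
  (varsX : variables phi = [set: X])
  (cnf3 : is_kcnf 3 phi)
  (unsat : ~ satisfiable phi)
  (wins : coverer_wins (adjacency_graph phi) mu) :
  exists W : factors X -> Prop, winning_strategy mu (tr_cnf F phi) W.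
Proof.
case: wins => s win.
have good h := legal_good (h := h) win.
pose fam := @component_family X phi.
(* Factors are compared with a legal position as a set and without [[set star X]], since [pf_le]
   sees neither their order nor the trivial factors. *)
exists (fun H => is_product_family H /\ exists2 h, legal mu s h &
  [set A | (A \in H) && (A != [set star X])] = fam @: components (position s h)).
split.
- exists [::]; split=> //; exists [::] => //=.
  by rewrite components_empty imset0; apply/setP=> A; rewrite !inE.
- move=> H [pfH [h leg E]]; split=> // A AH.
  have [->|As] := eqVneq A [set star X]; first exact: flippable_star.
  have : A \in [set A | (A \in H) && (A != [set star X])] by rewrite inE AH.
  rewrite E => /imsetP[K Kh ->].
  exact: component_family_flippable (good h leg K Kh).
- move=> H H' [pfH [h leg E]] pfH' le; split=> //.
  pose T := [set K in components (position s h) | fam K \in H'].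
  have [|h' leg' E'] := legal_remove (T := T) leg.
    by apply/subsetP=> K; rewrite inE => /andP[].
  exists h' => //; rewrite E'; apply/setP=> A; rewrite inE; apply/andP/imsetP.
    case=> AH' As.
    have : A \in [set A | (A \in H) && (A != [set star X])].
      by rewrite inE As le.
    rewrite E => /imsetP[K Kh AE]; exists K => //.
    by rewrite inE Kh -AE.
  case=> K; rewrite inE => /andP[Kh KH'] ->; split=> //.
  exact: component_family_neq_star (good h leg K Kh).
move=> H p [pfH [h leg E]] rk pP.
have answer v : exists H', [/\ is_product_family H' /\ (exists2 h', legal mu s h' &
      [set A | (A \in H') && (A != [set star X])] = fam @: components (position s h')),
    pf_le H H' & exists2 K, v \in sgV K & fam K \in H'].
  have legv : legal mu s (Defs.Pick v :: h).
    (* The pick is legal: distinct components have distinct families, so the rank of [H] is the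
       number of components in the position. *)
    rewrite /= leg /=; apply: leq_trans rk; rewrite ltnS rank_card // E.
    by rewrite card_in_imset //; apply: component_family_inj (good h leg).
  have [_ vV sub] := win h v legv.
  have gv := good _ legv.
  exists [seq fam K | K <- enum (components (s h v))]; split.
  - split; first exact: component_families_product gv.
    exists (Defs.Pick v :: h) => //; apply/setP=> A; rewrite inE; apply/andP/imsetP.
      by case=> /mapP[K]; rewrite mem_enum => Kh -> _; exists K.
    case=> K Kh ->; split; first by rewrite map_f // mem_enum.
    exact: component_family_neq_star (gv K Kh).
  - move=> A AH As.
    have : A \in [set A | (A \in H) && (A != [set star X])] by rewrite inE AH.
    rewrite E => /imsetP[K Kh ->]; rewrite map_f // mem_enum.
    exact: (subsetP sub).
  - exists (component_of (s h v) v); first exact: mem_component_of.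
    by rewrite map_f // mem_enum imset_f.
(* Picking [x] serves both axioms of [x], as members of the family of its component assign a value
   to [x]. *)
have assigned x : exists H', [/\ is_product_family H' /\ (exists2 h', legal mu s h' &
      [set A | (A \in H') && (A != [set star X])] = fam @: components (position s h')),
    pf_le H H' & forall a, a \in product_set H' -> exists c, a x = Some c].
  have [H' [[pfH' WH'] le [K xK KH']]] := answer (inr x).
  exists H'; split=> // a aH'.
  have [b + ext] := product_set_extends pfH' KH' aH'.
  rewrite inE => /andP[/eqP/setP/(_ x)]; rewrite !inE xK.
  by case bx: (b x) => [c|//] _ _; exists c; apply: ext.
case: pP => [[C Cphi ->]|[x ->]|[x ->]].
- have [H' [[pfH' WH'] le [K CK KH']]] := answer (inl (exist _ C Cphi)).
  exists H'; split=> // a aH'; apply: models_clause.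
  have [b + ext] := product_set_extends pfH' KH' aH'.
  rewrite inE => /andP[_ /forallP/(_ (exist _ C Cphi))]; rewrite inE CK /=.
  case/existsP=> l /andP[lC /eqP bl]; apply/existsP; exists l.
  by rewrite lC (ext _ _ bl) eqxx.
- have [H' [WH' le asg]] := assigned x; exists H'; split=> // a aH'.
  by have [c ax] := asg a aH'; apply: models_boolean ax.
have [H' [WH' le asg]] := assigned x; exists H'; split=> // a aH'.
by have [c ax] := asg a aH'; apply: models_twin ax.
Qed.
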